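(* Let $G_1$ and $G_2$ be graphs with disjoint vertex sets. Then $\mathrm{compthin}(G_1\cup G_2)=\mathrm{compthin}(G_1)+\mathrm{compthin}(G_2)$ and $\mathrm{comppthin}(G_1\cup G_2)=\mathrm{comppthin}(G_1)+\mathrm{comppthin}(G_2)$.
   Context: Graphs are finite, simple, undirected. The union $G_1\cup G_2$ is $(V_1\cup V_2, E_1\cup E_2)$. For a graph $G=(V,E)$, an ordering $v_1,\dots,v_n$ of $V$ and a partition of $V$ are consistent if for every $r<s<t$, whenever $v_r,v_s$ are in the same class and $v_tv_r\in E$, then $v_tv_s\in E$; they are strongly consistent if moreover for every $r<s<t$, whenever $v_s,v_t$ are in the same class and $v_tv_r\in E$, then $v_sv_r\in E$. $\mathrm{compthin}(G)$ (complete thinness) is the minimum $k$ such that some ordering of $V$ and some partition of $V$ into $k$ cliques are consistent; $\mathrm{comppthin}(G)$ (complete proper thinness) is defined likewise with strongly consistent. *)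

(* Defs.v *)
From mathcomp Require Import all_boot.

Set Implicit Arguments.
Unset Strict Implicit.
Unset Printing Implicit Defensive.

(* The vertex set is a subset of an ambient finite type T, so that the
   set-theoretic union of two graphs and the disjointness of their vertex sets
   can be stated literally. *)
Record sgraph (T : finType) := SGraph {
  vset : {set T};
  edge : rel T;
  edge_sym : symmetric edge;
  edge_irr : irreflexive edge;
  edge_vset : forall x y, edge x y -> (x \in vset) && (y \in vset)
}.

Section Union.
Variables (T : finType) (G H : sgraph T).

Definition gunion_edge : rel T := fun x y => edge G x y || edge H x y.

Lemma gunion_sym : symmetric gunion_edge.
Proof.
by move=> x y; rewrite /gunion_edge (edge_sym G) (edge_sym H).
Qed.

Lemma gunion_irr : irreflexive gunion_edge.
Proof. by move=> x; rewrite /gunion_edge !edge_irr. Qed.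

Lemma gunion_vset x y : gunion_edge x y ->
  (x \in vset G :|: vset H) && (y \in vset G :|: vset H).
Proof.
rewrite !inE => /orP[] /edge_vset /andP[-> ->] //.
by rewrite !orbT.
Qed.

Definition gunion : sgraph T := SGraph gunion_sym gunion_irr gunion_vset.

End Union.

Section Thinness.
Variables (T : finType) (G : sgraph T).

Local Notation n := #|vset G|.

Definition vertex_ordering (v : n.-tuple T) : bool :=
  uniq v && ([set x in v] == vset G).

Definition same_class (P : {set {set T}}) (x y : T) : bool :=
  [exists B in P, (x \in B) && (y \in B)].

Definition consistent (v : n.-tuple T) (P : {set {set T}}) : bool :=
  [forall r : 'I_n, forall s : 'I_n, forall t : 'I_n,
    [&& r < s, s < t, same_class P (tnth v r) (tnth v s)
      & edge G (tnth v t) (tnth v r)]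
    ==> edge G (tnth v t) (tnth v s)].

Definition strongly_consistent (v : n.-tuple T) (P : {set {set T}}) : bool :=
  consistent v P &&
  [forall r : 'I_n, forall s : 'I_n, forall t : 'I_n,
    [&& r < s, s < t, same_class P (tnth v s) (tnth v t)
      & edge G (tnth v t) (tnth v r)]
    ==> edge G (tnth v s) (tnth v r)].

Definition clique (B : {set T}) : bool :=
  [forall x in B, forall y in B, (x != y) ==> edge G x y].

(* The classes of a [partition] are nonempty, so #|P| is the number of classes. *)
Definition clique_partition (P : {set {set T}}) : bool :=
  partition P (vset G) && [forall B in P, clique B].

Definition complete_thin (k : nat) : bool :=
  [exists v : n.-tuple T, exists P : {set {set T}},
    [&& vertex_ordering v, clique_partition P, #|P| == k & consistent v P]].

Definition complete_proper_thin (k : nat) : bool :=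
  [exists v : n.-tuple T, exists P : {set {set T}},
    [&& vertex_ordering v, clique_partition P, #|P| == k
      & strongly_consistent v P]].

Lemma complete_proper_thinW k : complete_proper_thin k -> complete_thin k.
Proof.
case/existsP=> v /existsP[P /and4P[ov cP kP /andP[sP _]]].
by apply/existsP; exists v; apply/existsP; exists P; rewrite ov cP kP sP.
Qed.

Lemma complete_proper_thin_ex : exists k, complete_proper_thin k.
Proof.
pose P := [set [set x] | x in vset G].
have sz : size (enum (vset G)) == n by rewrite cardE.
pose v : n.-tuple T := Tuple sz.
have uv : uniq v by exact: enum_uniq.
have sameP x y : same_class P x y -> x = y.
  case/existsP=> B /and3P[/imsetP[z _ ->]].
  by rewrite !inE => /eqP-> /eqP->.
have tinj (i j : 'I_n) : i < j -> tnth v i = tnth v j -> false.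
  move=> lij eij; have x0 := tnth v i; move: eij; rewrite !(tnth_nth x0) => /eqP.
  by rewrite nth_uniq ?size_tuple // => /eqP eij; rewrite eij ltnn in lij.
exists #|P|; apply/existsP; exists v; apply/existsP; exists P.
apply/and4P; split=> //; last apply/andP; try split.
- by rewrite /vertex_ordering uv; apply/eqP/setP=> x; rewrite inE mem_enum.
- apply/andP; split; last first.
    apply/forall_inP=> B /imsetP[z _ ->].
    apply/forall_inP=> x /set1P->; apply/forall_inP=> y /set1P->.
    by rewrite eqxx.
  apply/and3P; split.
  + apply/eqP/setP=> x; apply/bigcupP/idP => [[B /imsetP[z zG ->] /set1P->] //|].
    by move=> xG; exists [set x]; rewrite ?set11 // imset_f.
  + apply/trivIsetP=> A B /imsetP[a _ ->] /imsetP[b _ ->] neq.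
    rewrite disjoints1 inE; apply: contraNneq neq => ->; exact: eqxx.
  + by apply/imsetP=> -[z _ /setP/(_ z)]; rewrite !inE eqxx.
- apply/'forall_'forall_forallP=> r s t; apply/implyP.
  by case/and4P=> lrs _ /sameP/(tinj _ _ lrs).
- apply/'forall_'forall_forallP=> r s t; apply/implyP.
  by case/and4P=> _ lst /sameP/(tinj _ _ lst).
Qed.

Lemma complete_thin_ex : exists k, complete_thin k.
Proof.
by have [k /complete_proper_thinW kP] := complete_proper_thin_ex; exists k.
Qed.

Definition compthin : nat := ex_minn complete_thin_ex.

Definition comppthin : nat := ex_minn complete_proper_thin_ex.

End Thinness.

(* Main.v *)
Require Import Defs.
From mathcomp Require Import all_boot.

(** An ordering only matters through an injective rank function, so restricting
    it to a subgraph is free and two orderings on disjoint vertex sets can be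
    interleaved by using even ranks for one and odd ranks for the other.  All
    constraints relate vertices of a single [Gi], because both an edge and a
    common class force their ends into the same [Gi]; hence witnesses for [G1]
    and [G2] combine.  Conversely a clique of the disjoint union lies inside one
    of the two graphs, so a clique partition of the union splits into clique
    partitions of [G1] and [G2] whose sizes add up. *)

Set Implicit Arguments.
Unset Strict Implicit.
Unset Printing Implicit Defensive.

(** * Rank functions in place of orderings *)

Section Ranked.
Variables (T : finType) (G : sgraph T).
Implicit Types (f : T -> nat) (P : {set {set T}}) (strong : bool).

(** Here [x], [y], [z] range over the whole ambient type: for a partition [P] of [vset G], the class
    and edge premises already force them to be vertices of [G]. *)
Definition forward_compatible f P :=
  forall x y z, f x < f y -> f y < f z ->
    same_class P x y -> edge G z x -> edge G z y.

Definition backward_compatible f P :=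
  forall x y z, f x < f y -> f y < f z ->
    same_class P y z -> edge G z x -> edge G y x.

(** The flag [strong] lets one argument serve both parameters. Injectivity is asked only on
    [vset G], so one rank function can be reused on a subgraph. *)
Definition ranked_thin strong k :=
  exists f P, [/\ {in vset G &, injective f}, clique_partition G P, #|P| = k,
    forward_compatible f P & strong -> backward_compatible f P].

Lemma edge_vsetl x y : edge G x y -> x \in vset G.
Proof. by case/edge_vset/andP. Qed.

Lemma edge_vsetr x y : edge G x y -> y \in vset G.
Proof. by case/edge_vset/andP. Qed.

Lemma same_class_sym P : symmetric (same_class P).
Proof. by move=> x y; apply: eq_existsb => B; rewrite [(x \in B) && _]andbC. Qed.

Lemma class_sub P B : clique_partition G P -> B \in P -> B \subset vset G.
Proof. by case/andP=> /and3P[/eqP <- _ _] _; apply: bigcup_sup. Qed.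

Lemma same_class_vset P x y :
  clique_partition G P -> same_class P x y -> (x \in vset G) && (y \in vset G).
Proof.
move=> cP /existsP[B /and3P[/(class_sub cP)/subsetP sBG xB yB]].
by rewrite !sBG.
Qed.

Section OfOrdering.
Variable v : #|vset G|.-tuple T.
Hypothesis ord_v : vertex_ordering v.

Lemma mem_ordering : v =i vset G.
Proof. by move=> x; case/andP: ord_v => _ /eqP/setP/(_ x); rewrite inE. Qed.

Lemma index_inj_ordering : {in vset G &, injective (fun x => index x v)}.
Proof. by move=> x y xG yG; apply: (@index_inj _ x v); rewrite mem_ordering. Qed.

Lemma ordering_pos x : x \in vset G ->
  exists2 i : 'I_#|vset G|, tnth v i = x & index x v = i.
Proof.
rewrite -mem_ordering => /tnthP[i ->]; exists i => //.
case/andP: ord_v => uv _.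
by rewrite (tnth_nth (tnth v i)) index_uniq ?size_tuple.
Qed.

(** The class puts [x] and [y] in [vset G] and the edge puts [z] there, so all three have positions
    in [v]. *)
Lemma consistent_forward P : clique_partition G P -> consistent v P ->
  forward_compatible (fun x => index x v) P.
Proof.
move=> cP cvP x y z lxy lyz xy zx.
have /andP[/ordering_pos[r rE ir] /ordering_pos[s sE is_]] :=
  same_class_vset cP xy.
have [t tE it_] := ordering_pos (edge_vsetl zx).
move: lxy lyz; rewrite ir is_ it_ => lrs lst.
have := forallP (forallP (forallP cvP r) s) t.
by rewrite rE sE tE lrs lst xy zx.
Qed.

Lemma strongly_consistent_backward P :
  clique_partition G P -> strongly_consistent v P ->
  backward_compatible (fun x => index x v) P.
Proof.
move=> cP /andP[_ cvP] x y z lxy lyz yz zx.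
have /andP[/ordering_pos[s sE is_] /ordering_pos[t tE it_]] :=
  same_class_vset cP yz.
have [r rE ir] := ordering_pos (edge_vsetr zx).
move: lxy lyz; rewrite ir is_ it_ => lrs lst.
have := forallP (forallP (forallP cvP r) s) t.
by rewrite rE sE tE lrs lst yz zx.
Qed.

End OfOrdering.

Lemma ordering_of_rank f : {in vset G &, injective f} ->
  exists2 v : #|vset G|.-tuple T, vertex_ordering v &
    forall i j : 'I_#|vset G|, i < j -> f (tnth v i) < f (tnth v j).
Proof.
move=> inj_f; pose s := sort (relpre f leq) (enum (vset G)).
have sz : size s == #|vset G| by rewrite size_sort cardE.
have us : uniq s by rewrite sort_uniq enum_uniq.
have ms : s =i vset G by move=> x; rewrite mem_sort mem_enum.
exists (Tuple sz) => [|i j lij].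
  by apply/andP; split=> //; apply/eqP/setP => x; rewrite inE ms.
have ss : sorted (relpre f leq) s.
  by apply: sort_sorted => x y; apply: leq_total.
have x0 := tnth (Tuple sz) i.
have [li lj] : i < size s /\ j < size s by rewrite (eqP sz).
rewrite !(tnth_nth x0) /= ltn_neqAle.
have -> : f (nth x0 s i) <= f (nth x0 s j).
  apply: (sorted_ltn_nth (leT := relpre f leq)) => // y x z.
  exact: leq_trans.
(* Sorting gives only a weak inequality. Equal ranks would mean equal entries, hence equal
   positions, since [s] is duplicate-free. *)
rewrite andbT; apply/negP => /eqP /inj_f.
rewrite -!ms !mem_nth // => /(_ isT isT) /eqP.
by rewrite nth_uniq // (ltn_eqF lij).
Qed.

Lemma complete_thinP k : reflect (ranked_thin false k) (complete_thin G k).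
Proof.
apply: (iffP idP) => [/existsP[v /existsP[P /and4P[ov cP /eqP kP cvP]]]|].
  exists (fun x => index x v), P; split=> //; first exact: index_inj_ordering.
  exact: consistent_forward.
case=> f [P [/ordering_of_rank[v ov vf] cP kP fP _]].
apply/existsP; exists v; apply/existsP; exists P; rewrite ov cP kP eqxx /=.
apply/'forall_'forall_forallP=> r s t; apply/implyP=> /and4P[lrs lst].
by apply: fP; apply: vf.
Qed.

Lemma complete_proper_thinP k :
  reflect (ranked_thin true k) (complete_proper_thin G k).
Proof.
apply: (iffP idP) => [/existsP[v /existsP[P /and4P[ov cP /eqP kP sP]]]|].
  exists (fun x => index x v), P; split=> //; first exact: index_inj_ordering.
    by apply: consistent_forward => //; case/andP: sP.
  by move=> _; apply: strongly_consistent_backward.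
case=> f [P [/ordering_of_rank[v ov vf] cP kP fP /(_ isT) bP]].
apply/existsP; exists v; apply/existsP; exists P; rewrite ov cP kP eqxx /=.
apply/andP; split; apply/'forall_'forall_forallP=> r s t;
  apply/implyP=> /and4P[lrs lst]; [apply: fP | apply: bP]; exact: vf.
Qed.

End Ranked.

(** * Restriction to a union of components *)

(* [H] is a union of connected components of [G]. *)
Section Restriction.
Variables (T : finType) (G H : sgraph T).
Hypothesis subHG : vset H \subset vset G.
Hypothesis edgeHG : forall x y, x \in vset H -> edge G x y = edge H x y.
Variable P : {set {set T}}.
Hypothesis cP : clique_partition G P.

(** Any other vertex of the clique [B] is adjacent to [x], and an edge of [G] at a vertex of [H] is
    an edge of [H], so its other end stays in [vset H]. *)
Lemma class_sub_component B x :
  B \in P -> x \in B -> x \in vset H -> B \subset vset H.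
Proof.
move=> PB xB xH; apply/subsetP=> y yB.
have [<- //|neq_xy] := eqVneq x y.
case/andP: cP => _ /forall_inP/(_ B PB)/forall_inP/(_ x xB)/forall_inP/(_ y yB).
by rewrite neq_xy /= edgeHG // => /edge_vsetr.
Qed.

(** [P ::&: vset H] selects the whole classes contained in [vset H]. They cover it because no class
    straddles its boundary. *)
Lemma clique_partition_restrict : clique_partition H (P ::&: vset H).
Proof.
have /andP[/and3P[/eqP covP trP P0] /forall_inP clP] := cP.
apply/andP; split; last first.
  apply/forall_inP=> B /setIdP[PB sBH].
  apply/forall_inP=> x xB; apply/forall_inP=> y yB.
  rewrite -edgeHG ?(subsetP sBH) //.
  exact: (forall_inP (forall_inP (clP B PB) x xB) y yB).
apply/and3P; split.
- apply/eqP/setP=> x; apply/bigcupP/idP => [[B /setIdP[_ sBH]]|xH].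
    exact: (subsetP sBH).
  have: x \in cover P by rewrite covP (subsetP subHG).
  case/bigcupP=> B PB xB; exists B => //.
  by rewrite inE PB (class_sub_component PB xB xH).
- apply: trivIsetS trP; apply/subsetP=> B.
  by case/setIdP.
- by apply: contra P0 => /setIdP[].
Qed.

Lemma same_class_restrict x y :
  same_class (P ::&: vset H) x y -> same_class P x y.
Proof.
case/existsP=> B /andP[/setIdP[PB _] xyB].
by apply/existsP; exists B; rewrite PB.
Qed.

Lemma ranked_thin_restrict f (strong : bool) :
  {in vset G &, injective f} -> forward_compatible G f P ->
  (strong -> backward_compatible G f P) ->
  ranked_thin H strong #|P ::&: vset H|.
Proof.
move=> inj_f fP bP; exists f, (P ::&: vset H); split=> //.
- by move=> x y /(subsetP subHG) xG /(subsetP subHG) yG; apply: inj_f.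
- exact: clique_partition_restrict.
- move=> x y z lxy lyz /same_class_restrict xy zx.
  have zH := edge_vsetl zx.
  by rewrite -edgeHG //; apply: fP xy _; rewrite ?edgeHG.
- move=> /bP{}bP x y z lxy lyz /same_class_restrict yz zx.
  have [zH xH] := (edge_vsetl zx, edge_vsetr zx).
  (* [edgeHG] needs its first end in [vset H], which is known for [x] but not for [y]; hence the two
     uses of symmetry. *)
  by rewrite edge_sym -edgeHG // edge_sym; apply: bP yz _; rewrite ?edgeHG.
Qed.

End Restriction.

(** * Splitting and joining witnesses for a disjoint union *)

Section DisjointUnion.
Variables (T : finType) (G1 G2 : sgraph T).
Hypothesis dis : [disjoint vset G1 & vset G2].

Lemma gunion_edgel x y : x \in vset G1 -> edge (gunion G1 G2) x y = edge G1 x y.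
Proof.
move=> x1; rewrite /= /gunion_edge; case: (boolP (edge G2 x y)) => [/edge_vsetl|].
  by rewrite (disjointFr dis x1).
by rewrite orbF.
Qed.

Lemma gunion_edger x y : x \in vset G2 -> edge (gunion G1 G2) x y = edge G2 x y.
Proof.
move=> x2; rewrite /= /gunion_edge; case: (boolP (edge G1 x y)) => [/edge_vsetl|//].
by rewrite (disjointFl dis x2).
Qed.

Lemma ranked_thin_gunion_split strong k :
  ranked_thin (gunion G1 G2) strong k ->
  exists i j, [/\ k = i + j, ranked_thin G1 strong i & ranked_thin G2 strong j].
Proof.
case=> f [P [inj_f cP <- fP bP]].
exists #|P ::&: vset G1|, #|P ::&: vset G2|; split; last first.
- apply: ranked_thin_restrict gunion_edger _ cP _ _ inj_f fP bP.
  exact: subsetUr.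
- apply: ranked_thin_restrict gunion_edgel _ cP _ _ inj_f fP bP.
  exact: subsetUl.
have /andP[/and3P[/eqP covP _ P0] _] := cP.
(* A class inside both disjoint vertex sets would be empty, which a partition excludes. *)
rewrite -cardsUI; have -> : (P ::&: vset G1) :&: (P ::&: vset G2) = set0.
  apply/setP=> B; rewrite !inE; apply/negP.
  case/andP=> /andP[PB sB1] /andP[_ sB2].
  have [B0|[x xB]] := set_0Vmem B; first by rewrite -B0 PB in P0.
  by have := disjointFr dis (subsetP sB1 x xB); rewrite (subsetP sB2).
(* Conversely every class has a vertex in one of the two graphs, and then lies wholly inside that
   graph. *)
rewrite cards0 addn0; congr #|pred_of_set _|; apply/setP=> B.
rewrite !inE -andb_orr; case: (boolP (B \in P)) => //= PB; apply/esym.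
have [B0|[x xB]] := set_0Vmem B; first by rewrite -B0 PB in P0.
have: x \in cover P by apply/bigcupP; exists B.
rewrite covP => /setUP[xG|xG].
  by rewrite (class_sub_component gunion_edgel cP PB xB xG).
by rewrite (class_sub_component gunion_edger cP PB xB xG) orbT.
Qed.

Section Join.
Variables (P1 P2 : {set {set T}}).
Hypotheses (cP1 : clique_partition G1 P1) (cP2 : clique_partition G2 P2).

Lemma clique_partition_join : clique_partition (gunion G1 G2) (P1 :|: P2).
Proof.
have /andP[/and3P[/eqP cov1 /trivIsetP tr1 P10] /forall_inP cl1] := cP1.
have /andP[/and3P[/eqP cov2 /trivIsetP tr2 P20] /forall_inP cl2] := cP2.
apply/andP; split; last first.
  apply/forall_inP=> B /setUP[PB|PB]; apply/forall_inP=> x xB;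
    apply/forall_inP=> y yB; apply/implyP=> neq_xy.
    by rewrite gunion_edgel ?(subsetP (class_sub cP1 PB)) //;
      apply: (implyP (forall_inP (forall_inP (cl1 B PB) x xB) y yB)).
  by rewrite gunion_edger ?(subsetP (class_sub cP2 PB)) //;
    apply: (implyP (forall_inP (forall_inP (cl2 B PB) x xB) y yB)).
apply/and3P; split; last by rewrite inE negb_or P10.
  by rewrite /cover bigcup_setU -!/(cover _) cov1 cov2.
have dis12 A B : A \in P1 -> B \in P2 -> [disjoint A & B].
  by move=> /(class_sub cP1) sA /(class_sub cP2) sB; apply: disjointWl sA (disjointWr sB dis).
apply/trivIsetP=> A B /setUP[PA|PA] /setUP[PB|PB] neq_AB.
- exact: tr1.
- exact: dis12.
- by rewrite disjoint_sym; apply: dis12.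
- exact: tr2.
Qed.

Lemma card_join : #|P1 :|: P2| = #|P1| + #|P2|.
Proof.
rewrite -cardsUI; have -> : P1 :&: P2 = set0; last by rewrite cards0 addn0.
apply/setP=> B; rewrite !inE; apply/negP => /andP[B1 B2].
have [B0|[x xB]] := set_0Vmem B.
  by case/andP: cP1 => /and3P[_ _]; rewrite -B0 B1.
have := disjointFr dis (subsetP (class_sub cP1 B1) x xB).
by rewrite (subsetP (class_sub cP2 B2)).
Qed.

Lemma same_class_joinl x y :
  x \in vset G1 -> same_class (P1 :|: P2) x y -> same_class P1 x y.
Proof.
move=> x1 /existsP[B /and3P[/setUP[PB|PB] xB yB]].
  by apply/existsP; exists B; rewrite PB xB.
by have := disjointFr dis x1; rewrite (subsetP (class_sub cP2 PB)).
Qed.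

Lemma same_class_joinr x y :
  x \in vset G2 -> same_class (P1 :|: P2) x y -> same_class P2 x y.
Proof.
move=> x2 /existsP[B /and3P[/setUP[PB|PB] xB yB]]; last first.
  by apply/existsP; exists B; rewrite PB xB.
by have := disjointFl dis x2; rewrite (subsetP (class_sub cP1 PB)).
Qed.

End Join.

(** Doubling keeps the order within each graph, and parity separates the two. Points outside both
    graphs also get odd ranks, harmlessly. *)
Definition interleave (f1 f2 : T -> nat) x :=
  if x \in vset G1 then (f1 x).*2 else (f2 x).*2.+1.

Lemma interleavel f1 f2 x : x \in vset G1 -> interleave f1 f2 x = (f1 x).*2.
Proof. by rewrite /interleave => ->. Qed.

Lemma interleaver f1 f2 x : x \in vset G2 -> interleave f1 f2 x = (f2 x).*2.+1.
Proof. by rewrite /interleave => x2; rewrite (disjointFl dis x2). Qed.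

Lemma interleave_inj f1 f2 :
  {in vset G1 &, injective f1} -> {in vset G2 &, injective f2} ->
  {in vset (gunion G1 G2) &, injective (interleave f1 f2)}.
Proof.
move=> inj1 inj2 x y /setUP[xG|xG] /setUP[yG|yG];
  rewrite ?(interleavel _ _ xG) ?(interleaver _ _ xG)
          ?(interleavel _ _ yG) ?(interleaver _ _ yG).
- by move=> /double_inj; apply: inj1.
- by move=> /(congr1 odd); rewrite /= !odd_double.
- by move=> /(congr1 odd); rewrite /= !odd_double.
- by case=> /double_inj; apply: inj2.
Qed.

Lemma ranked_thin_gunion_join strong i j :
  ranked_thin G1 strong i -> ranked_thin G2 strong j ->
  ranked_thin (gunion G1 G2) strong (i + j).
Proof.
case=> f1 [P1 [inj1 cP1 <- fP1 bP1]] [f2 [P2 [inj2 cP2 <- fP2 bP2]]].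
exists (interleave f1 f2), (P1 :|: P2); split.
- exact: interleave_inj.
- exact: clique_partition_join.
- exact: card_join.
(* The edge decides which graph is concerned, and the class shared with [x] then brings [y] into
   it. *)
- move=> x y z lxy lyz xy /orP[] zx; have [zG xG] := (edge_vsetl zx, edge_vsetr zx).
    have {}xy := same_class_joinl cP2 xG xy.
    have /andP[_ yG] := same_class_vset cP1 xy.
    move: lxy lyz; rewrite !interleavel // !ltn_double => lxy lyz.
    by apply/orP; left; apply: fP1 xy zx.
  have {}xy := same_class_joinr cP1 xG xy.
  have /andP[_ yG] := same_class_vset cP2 xy.
  move: lxy lyz; rewrite !interleaver // !ltnS !ltn_double => lxy lyz.
  by apply/orP; right; apply: fP2 xy zx.
move=> st x y z lxy lyz.
(* The class pair is flipped so that [z], located by the edge, comes first, as [same_class_joinl]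
   and [same_class_joinr] require. *)
rewrite same_class_sym => zy /orP[] zx; have [zG xG] := (edge_vsetl zx, edge_vsetr zx).
  have {}zy := same_class_joinl cP2 zG zy.
  have /andP[_ yG] := same_class_vset cP1 zy.
  move: lxy lyz; rewrite !interleavel // !ltn_double => lxy lyz.
  by apply/orP; left; apply: bP1 zx => //; rewrite same_class_sym.
have {}zy := same_class_joinr cP1 zG zy.
have /andP[_ yG] := same_class_vset cP2 zy.
move: lxy lyz; rewrite !interleaver // !ltnS !ltn_double => lxy lyz.
by apply/orP; right; apply: bP2 zx => //; rewrite same_class_sym.
Qed.

End DisjointUnion.

(** * Additivity of the minima *)

Lemma ex_minn_add (P Q R : pred nat) (exP : exists n, P n)
    (exQ : exists n, Q n) (exR : exists n, R n) :
  (forall i j, P i -> Q j -> R (i + j)) ->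
  (forall k, R k -> exists i j, [/\ k = i + j, P i & Q j]) ->
  ex_minn exR = ex_minn exP + ex_minn exQ.
Proof.
move=> joinR splitR.
case: ex_minnP => k /splitR[i [j [-> Pi Qj]]] min_k.
case: ex_minnP => m Pm min_m; case: ex_minnP => n Qn min_n.
(* Joining the two minimal witnesses bounds [i + j] above by [m + n]; minimality of [m] and [n]
   gives the reverse. *)
by apply/eqP; rewrite eqn_leq min_k ?joinR // leq_add ?min_m ?min_n.
Qed.

Theorem theorem4p10 (T : finType) (G1 G2 : sgraph T)
    (dis : [disjoint vset G1 & vset G2]) :
  compthin (gunion G1 G2) = compthin G1 + compthin G2 /\
  comppthin (gunion G1 G2) = comppthin G1 + comppthin G2.
Proof.
split; apply: ex_minn_add.
- move=> i j /complete_thinP Gi /complete_thinP Gj.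
  exact/complete_thinP/ranked_thin_gunion_join.
- move=> k /complete_thinP/(ranked_thin_gunion_split dis)[i [j [-> Gi Gj]]].
  by exists i, j; split=> //; apply/complete_thinP.
- move=> i j /complete_proper_thinP Gi /complete_proper_thinP Gj.
  exact/complete_proper_thinP/ranked_thin_gunion_join.
- move=> k /complete_proper_thinP/(ranked_thin_gunion_split dis)[i [j [-> Gi Gj]]].
  by exists i, j; split=> //; apply/complete_proper_thinP.
Qed.
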